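(* Let $D$ be the classical second order derivative operator on a uniform grid with spacing $h>0$, either periodic or with the boundary closures given in the context. Let $m\ge 1$, let $f\colon\mathbb{R}^m\to\mathbb{R}$ be continuously differentiable, and let $A_{f'}$ be the (possibly nonlinear) averaging operator given in the context. Then for every grid function $\mathbf{u}$ with values in $\mathbb{R}^m$ the chain rule $$D f(\mathbf{u}) = (A_{f'}\mathbf{u})\cdot(D\mathbf{u})$$ holds (at every node). Moreover, $A_{f'}$ is of the same order of accuracy as $D$, i.e. for smooth $f$ and a smooth (possibly vector-valued) function $u$ with grid values $\mathbf{u}_i=u(x_i)$ one has, as $h\to0$, $(A_{f'}\mathbf{u})_i=f'(u(x_i))+\mathcal{O}(h^2)$ at interior nodes (all nodes in the periodic case) and, in the non-periodic case, $(A_{f'}\mathbf{u})_{i}=f'(u(x_{i}))+\mathcal{O}(h)$ at the boundary nodes $i\in\{0,N\}$.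
   Context: A grid function is a family $\mathbf{u}=(\mathbf{u}_i)_i$ of values at the nodes $x_i$; it may be scalar- or vector-valued (values in $\mathbb{R}^m$), and $D$ acts componentwise. Compositions are pointwise: $f(\mathbf{u})_i=f(\mathbf{u}_i)$. $f'$ denotes the gradient of $f$ and $\cdot$ the Euclidean inner product in $\mathbb{R}^m$ (taken node by node). The grid is uniform, $x_{i+1}-x_i=h$. Periodic case: indices are taken modulo the number of nodes (and smooth functions $u$ are periodic), and for every $i$ $$(D\mathbf{u})_i=\frac{\mathbf{u}_{i+1}-\mathbf{u}_{i-1}}{2h},\qquad (A_{f'}\mathbf{u})_i=\int_0^1 f'\bigl(\mathbf{u}_{i-1}+s(\mathbf{u}_{i+1}-\mathbf{u}_{i-1})\bigr)\,ds.$$ Non-periodic case (summation-by-parts operator) with nodes $x_0,\dots,x_N$: the same formulas are used at the interior nodes $1\le i\le N-1$, together with the boundary closures $$(D\mathbf{u})_0=\frac{\mathbf{u}_1-\mathbf{u}_0}{h},\qquad (D\mathbf{u})_N=\frac{\mathbf{u}_N-\mathbf{u}_{N-1}}{h},$$ $$(A_{f'}\mathbf{u})_0=\int_0^1 f'\bigl(\mathbf{u}_{0}+s(\mathbf{u}_{1}-\mathbf{u}_{0})\bigr)\,ds,\qquad (A_{f'}\mathbf{u})_N=\int_0^1 f'\bigl(\mathbf{u}_{N-1}+s(\mathbf{u}_{N}-\mathbf{u}_{N-1})\bigr)\,ds.$$ *)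

(* Defs.v *)
From HB Require Import structures.
From mathcomp Require Import all_boot all_order all_algebra.
From mathcomp Require Import all_classical all_reals all_analysis.
Set Implicit Arguments.
Unset Strict Implicit.
Unset Printing Implicit Defensive.
Import Order.TTheory GRing.Theory Num.Theory.
Import numFieldNormedType.Exports.
Local Open Scope classical_set_scope.
Local Open Scope ring_scope.

Definition dotv (R : realType) (m : nat) (v w : 'rV[R]_m) : R :=
  \sum_(j < m) v 0 j * w 0 j.

Definition gradient (R : realType) (m : nat) (f : 'rV[R]_m -> R)
    (x : 'rV[R]_m) : 'rV[R]_m :=
  \row_(j < m) 'D_(delta_mx 0 j) f x.

Fixpoint class_C (R : realType) (m k : nat) (f : 'rV[R]_m -> R) : Prop :=
  if k is k'.+1 then
    (forall x, differentiable f x) /\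
    (forall j, class_C k' (fun x => gradient f x 0 j))
  else continuous f.

Definition smooth (R : realType) (m : nat) (f : 'rV[R]_m -> R) : Prop :=
  forall k, class_C k f.

Definition smooth_curve (R : realType) (m : nat) (u : R -> 'rV[R]_m) : Prop :=
  forall (k : nat) (x : R), derivable (derive1n k u) x 1.

(* C^oo on the closed interval [a, b]: [v k] is the k-th derivative of [u] on
   ]a, b[, extended by continuity to the endpoints.  The values of [u] outside
   [a, b] are irrelevant. *)
Definition smooth_curve_on (R : realType) (m : nat) (a b : R)
    (u : R -> 'rV[R]_m) : Prop :=
  exists v : nat -> R -> 'rV[R]_m,
    {in `[a, b], v 0%N =1 u} /\
    forall k, derivable_oo_LRcontinuous (v k) a b /\
              {in `]a, b[, derive1 (v k) =1 v k.+1}.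

(* The integral over s in [0, 1] of g (v + s (w - v)), componentwise. *)
Definition segment_mean (R : realType) (m : nat) (g : 'rV[R]_m -> 'rV[R]_m)
    (v w : 'rV[R]_m) : 'rV[R]_m :=
  \row_(j < m) \int[lebesgue_measure]_(s in `[0%R, 1%R]) g (v + s *: (w - v)) 0 j.

(* Periodic grids: [ordS] and [ord_pred] are the cyclic successor and
   predecessor on 'I_n. *)
Definition D_per (R : realType) (V : lmodType R) (n : nat) (h : R)
    (u : 'I_n -> V) (i : 'I_n) : V :=
  (2 * h)^-1 *: (u (ordS i) - u (ord_pred i)).

Definition A_per (R : realType) (m n : nat) (g : 'rV[R]_m -> 'rV[R]_m)
    (u : 'I_n -> 'rV[R]_m) (i : 'I_n) : 'rV[R]_m :=
  segment_mean g (u (ord_pred i)) (u (ordS i)).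

(* Non-periodic grids: the nodes are 0, ..., N; only meaningful for 0 < N. *)
Definition D_sbp (R : realType) (V : lmodType R) (N : nat) (h : R)
    (u : 'I_N.+1 -> V) (i : 'I_N.+1) : V :=
  if i == ord0 then h^-1 *: (u (inord 1) - u ord0)
  else if i == ord_max then h^-1 *: (u ord_max - u (inord N.-1))
  else (2 * h)^-1 *: (u (inord i.+1) - u (inord i.-1)).

Definition A_sbp (R : realType) (m N : nat) (g : 'rV[R]_m -> 'rV[R]_m)
    (u : 'I_N.+1 -> 'rV[R]_m) (i : 'I_N.+1) : 'rV[R]_m :=
  if i == ord0 then segment_mean g (u ord0) (u (inord 1))
  else if i == ord_max then segment_mean g (u (inord N.-1)) (u ord_max)
  else segment_mean g (u (inord i.-1)) (u (inord i.+1)).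

Definition node (R : realType) (x0 h : R) (n : nat) (i : 'I_n) : R :=
  x0 + i%:R * h.

(* Main.v *)
Require Import Defs.
From HB Require Import structures.
From mathcomp Require Import all_boot all_order all_algebra.
From mathcomp Require Import all_classical all_reals all_analysis.
From mathcomp Require Import ring lra.
Set Implicit Arguments.
Unset Strict Implicit.
Unset Printing Implicit Defensive.
Import Order.TTheory GRing.Theory Num.Theory.
Import numFieldNormedType.Exports.
Local Open Scope classical_set_scope.
Local Open Scope ring_scope.

(** The averaging operator is the mean of the gradient over the segment joining
    the two neighbouring nodal values v and w.  The chain rule is therefore the
    fundamental theorem of calculus for t |-> f (v + t (w - v)), whose
    derivative is the gradient of f along the segment, dotted with w - v
    (chain_rule_segment_mean); it is divided by h or 2h at each node.

    For the accuracy, let g be a component of the gradient, of class C^2, and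
    let c be the nodal value at which the mean of g is compared with g.  At the
    boundary nodes a Lipschitz bound on g suffices: the points of the segment
    are O(h) away from c.  At the interior nodes, g is replaced by its first
    order Taylor polynomial at c, with an error O(h^2); the mean of this affine
    function over the segment is its value at the midpoint (v + w) / 2
    (Rintegral_affine_approx), and the midpoint is O(h^2) away from c, because
    (u (x - h) + u (x + h)) / 2 - u x is half a second difference of u
    (midpoint_curve).  Both bounds are in segment_integral_bounds.

    The constants do not depend on the node: u maps the compact interval into
    a ball, where the derivatives of g are bounded, and the derivatives of u
    are bounded on the interval.  The periodic case is reduced to an interval
    by the periodicity of u: the cyclic neighbours of the node x carry the
    values u (x - h) and u (x + h), and these points stay within one period L
    of x0. *)

(** * Row vectors, the max norm and the gradient *)

Lemma subr_rVE (R : realType) (m : nat) (v w : 'rV[R]_m) j :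
  (v - w) 0 j = v 0 j - w 0 j.
Proof. by rewrite !mxE. Qed.

Lemma norm_rV_le (R : realType) (m : nat) (v : 'rV[R]_m) (c : R) :
  0 <= c -> (forall j, `|v 0 j| <= c) -> `|v| <= c.
Proof.
move=> c0 vc; rewrite [leLHS]/Num.Def.normr/= mx_normrE.
by apply: bigmax_le => // -[i j] _ /=; rewrite ord1.
Qed.

Lemma coord_le_norm (R : realType) (m : nat) (v : 'rV[R]_m) j :
  `|v 0 j| <= `|v|.
Proof.
rewrite [leRHS]/Num.Def.normr/= mx_normrE.
exact: (@le_bigmax _ _ _ _ (fun ij : 'I_1 * 'I_m => `|v ij.1 ij.2|) (0, j)).
Qed.

Lemma norm_dotv_le (R : realType) (m : nat) (v w : 'rV[R]_m) (c : R) :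
  (forall j, `|v 0 j| <= c) -> `|dotv v w| <= c * m%:R * `|w|.
Proof.
move=> vc; rewrite (le_trans (ler_norm_sum _ _ _))//.
rewrite (@le_trans _ _ (\sum_(j < m) c * `|w|))//.
  by apply: ler_sum => j _; rewrite normrM ler_pM// coord_le_norm.
by rewrite sumr_const card_ord -mulrA [m%:R * _]mulrC mulr_natr mulrnAr.
Qed.

Lemma dotvZr (R : realType) (m : nat) (k : R) (v w : 'rV[R]_m) :
  dotv v (k *: w) = k * dotv v w.
Proof.
by rewrite /dotv mulr_sumr; apply: eq_bigr => j _; rewrite mxE mulrCA.
Qed.

Lemma derive_dotv_gradient (R : realType) (m : nat) (f : 'rV[R]_m -> R)
    (x v : 'rV[R]_m) :
  differentiable f x -> 'D_v f x = dotv (gradient f x) v.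
Proof.
move=> df; rewrite deriveE// {1}(row_sum_delta v) linear_sum.
apply: eq_bigr => j _; rewrite linearZ mxE deriveE//.
exact: mulrC.
Qed.

Lemma class_C_continuous (R : realType) (m k : nat) (f : 'rV[R]_m -> R) :
  class_C k f -> continuous f.
Proof.
by case: k => [//|k] [df _] x; exact/differentiable_continuous.
Qed.

(** * Restrictions to line segments *)

Lemma is_derive_line (R : realType) (m : nat) (f : 'rV[R]_m -> R)
    (p d : 'rV[R]_m) (t : R) : differentiable f (p + t *: d) ->
  is_derive t 1 (fun s : R => f (p + s *: d))
    (dotv (gradient f (p + t *: d)) d).
Proof.
move=> df.
(* The difference quotients of f at p + t d in direction d and of the
   restriction of f to the line coincide. *)
have E : (fun h : R => h^-1 *: (f (h *: d + (p + t *: d)) - f (p + t *: d)))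
   = (fun h : R => h^-1 *: (f (p + (h *: (1 : R) + t) *: d) - f (p + t *: d))).
  apply/funext => h; congr (_ *: (f _ - _)).
  by rewrite scalerDl addrCA [h *: 1]mulr1.
have dd : derivable f (p + t *: d) d by exact: diff_derivable.
split.
  by move: dd; rewrite /derivable E.
by rewrite -derive_dotv_gradient// /derive E.
Qed.

Lemma line_continuous (R : realType) (m : nat) (p d : 'rV[R]_m) :
  continuous (fun t : R => p + t *: d).
Proof.
move=> t; apply: cvgD; first exact: cvg_cst.
exact: scalel_continuous.
Qed.

Lemma mean_value_rV (R : realType) (m : nat) (f : 'rV[R]_m -> R)
    (v w : 'rV[R]_m) : (forall x, differentiable f x) ->
  exists2 c : R, 0 <= c <= 1 &
    f w - f v = dotv (gradient f (v + c *: (w - v))) (w - v).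
Proof.
move=> df.
have dl (t : R) := is_derive_line (df (v + t *: (w - v))).
have cl : {within `[0, 1], continuous (fun t : R => f (v + t *: (w - v)))}.
  apply: continuous_subspaceT => t; apply: differentiable_continuous.
  by apply/derivable1_diffP; have := dl t.
have [c] := MVT_segment ler01 (fun t _ => dl t) cl.
rewrite in_itv/= subr0 mulr1 scale1r scale0r addr0 (addrC v) subrK => c01 E.
by exists c.
Qed.

(** * Integrals over [0, 1] and the chain rule on a segment *)

(** The fundamental theorem of calculus on [0, 1]. *)
Lemma Rintegral_derive (R : realType) (F F' : R -> R) :
  continuous F' -> (forall t : R, is_derive t 1 F (F' t)) ->
  \int[lebesgue_measure]_(s in `[0 : R, 1]) F' s = F 1 - F 0.
Proof.
move=> cF' dF; have cF : continuous F.
  move=> t; apply: differentiable_continuous; apply/derivable1_diffP.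
  by have := dF t.
rewrite /Rintegral (@continuous_FTC2 _ F' F)//.
- exact: continuous_subspaceT.
- split; first by move=> t _; have := dF t.
  + exact/cvg_at_right_filter/cF.
  + exact/cvg_at_left_filter/cF.
- by move=> t _; rewrite derive1E; apply: derive_val.
Qed.

Lemma continuous01_integrable (R : realType) (F : R -> R) : continuous F ->
  lebesgue_measure.-integrable `[0 : R, 1] (EFin \o F).
Proof.
move=> cF; apply: continuous_compact_integrable; first exact: segment_compact.
exact: continuous_subspaceT.
Qed.

Lemma Rintegral_continuous_sum (R : realType) (m : nat) (F : 'I_m -> R -> R)
    (d : 'I_m -> R) : (forall j, continuous (F j)) ->
  \int[lebesgue_measure]_(s in `[0 : R, 1]) (\sum_(j < m) F j s * d j) =
  \sum_(j < m) (\int[lebesgue_measure]_(s in `[0 : R, 1]) F j s) * d j.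
Proof.
move=> cF.
have iFd j := continuous01_integrable (cF j).
rewrite {1}/Rintegral.
under eq_integral do rewrite -sumEFin.
rewrite integral_sum//=; last first.
  move=> j; apply: (@continuous01_integrable R (fun s => F j s * d j)) => s.
  by apply: cvgM; [exact: cF | exact: cvg_cst].
rewrite -sum_fine; last first.
  move=> j _; apply: integrable_fin_num => //.
  apply: (@continuous01_integrable R (fun s => F j s * d j)) => s.
  by apply: cvgM; [exact: cF | exact: cvg_cst].
by apply: eq_bigr => j _; rewrite -RintegralZr.
Qed.

Lemma affine_continuous (R : realType) (a b : R) :
  continuous (fun s : R => a + s * b).
Proof.
move=> s; apply: cvgD; first exact: cvg_cst.
by apply: cvgM; [exact: cvg_id|exact: cvg_cst].
Qed.

Lemma is_derive_quadratic (R : realType) (a b t : R) :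
  is_derive t 1 (a *: (@id R) + (b / 2) *: ((@id R) * (@id R)) : R -> R)
    (a + t * b).
Proof.
apply: (@is_derive_eq _ _ _ _ _ _ _ _ (is_deriveD
  (is_deriveZ a (is_derive_id t 1))
  (is_deriveZ (b / 2) (is_deriveM (is_derive_id t 1) (is_derive_id t 1))))).
rewrite /GRing.scale/= !mulr1.
by rewrite -mulr2n -[t *+ 2]mulr_natr mulrCA divfK.
Qed.

Lemma Rintegral_affine (R : realType) (a b : R) :
  \int[lebesgue_measure]_(s in `[0 : R, 1]) (a + s * b) = a + b / 2.
Proof.
rewrite (Rintegral_derive (@affine_continuous R a b)
  (is_derive_quadratic a b)) !fctE /GRing.scale/=; by field.
Qed.

(** If F is within e of an affine function on [0, 1], then its mean is within e
    of the mean of this affine function, that is, of its value at 1 / 2. *)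
Lemma Rintegral_affine_approx (R : realType) (F : R -> R) (a b e : R) :
  continuous F -> (forall s, 0 <= s <= 1 -> `|F s - (a + s * b)| <= e) ->
  `|\int[lebesgue_measure]_(s in `[0 : R, 1]) F s - (a + b / 2)| <= e.
Proof.
move=> cF Fe.
have iF := continuous01_integrable cF.
have ia (k : R) := continuous01_integrable (@affine_continuous R k b).
have le01 (s : R) : `[0 : R, 1]%classic s -> 0 <= s <= 1 by rewrite /= in_itv.
have h1 : \int[lebesgue_measure]_(s in `[0 : R, 1]) F s <= (a + e) + b / 2.
  rewrite -Rintegral_affine; apply: le_Rintegral => //= s /le01/Fe.
  by rewrite ler_norml => /andP[_]; lra.
have h2 : (a - e) + b / 2 <= \int[lebesgue_measure]_(s in `[0 : R, 1]) F s.
  rewrite -Rintegral_affine; apply: le_Rintegral => //= s /le01/Fe.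
  by rewrite ler_norml => /andP[+ _]; lra.
by rewrite ler_norml; apply/andP; split; lra.
Qed.

(** The chain rule on a single segment; the difference operators only divide
    both sides by h or 2h. *)
Lemma chain_rule_segment_mean (R : realType) (m : nat) (f : 'rV[R]_m -> R)
    (v w : 'rV[R]_m) : class_C 1 f ->
  f w - f v = dotv (segment_mean (gradient f) v w) (w - v).
Proof.
move=> [df cf].
have cg (j : 'I_m) :
    continuous (fun s : R => gradient f (v + s *: (w - v)) 0 j).
  move=> t; apply: (@continuous_comp _ _ _ (fun s : R => v + s *: (w - v))
    (fun x => gradient f x 0 j)); last exact: cf.
  exact: line_continuous.
have := @Rintegral_derive R (fun s => f (v + s *: (w - v)))
  (fun s => dotv (gradient f (v + s *: (w - v))) (w - v)) _
  (fun t => is_derive_line (df (v + t *: (w - v)))).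
rewrite scale1r scale0r addr0 (addrC v) subrK => <-; last first.
  apply: continuous_big; first exact: add_continuous.
  by move=> j _ t; apply: cvgM; [exact: cg | exact: cvg_cst].
rewrite Rintegral_continuous_sum; last exact: cg.
by apply: eq_bigr => j _; rewrite [segment_mean _ _ _ _ _]mxE.
Qed.

(** * Uniform estimates on balls *)

(** Closed balls are convex. *)
Lemma norm_segment_le (R : realType) (m : nat) (v w p : 'rV[R]_m) (s B : R) :
  0 <= s <= 1 -> `|v - p| <= B -> `|w - p| <= B ->
  `|v + s *: (w - v) - p| <= B.
Proof.
move=> /andP[s0 s1] vB wB.
have -> : v + s *: (w - v) - p = (1 - s) *: (v - p) + s *: (w - p).
  by apply/rowP => j; rewrite !mxE; ring.
rewrite (le_trans (ler_normD _ _))// !normrZ ger0_norm ?subr_ge0// ger0_norm//.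
by have : 0 <= 1 - s by [lra]; nra.
Qed.

Lemma bounded_on_ball (R : realType) (m : nat) (g : 'rV[R]_m -> R) (B : R) :
  continuous g -> exists2 K, 0 <= K & forall x, `|x| <= B -> `|g x| <= K.
Proof.
move=> cg.
(* For the max norm, the closed ball is a product of compact intervals. *)
have cB : compact [set v : 'rV[R]_m | forall j, `[- B, B]%classic (v ord0 j)].
  apply: (rV_compact (A := fun=> `[- B, B]%classic)) => _.
  exact: segment_compact.
have /compact_bounded[K [_ gK]] :=
  continuous_compact (continuous_subspaceT cg) cB.
exists (`|K| + 1) => [|x xB]; first by rewrite addr_ge0.
apply: (gK (`|K| + 1)); first by rewrite ltr_pwDr// ler_norm.
exists x => // j /=.
by rewrite in_itv/= -ler_norml (le_trans (coord_le_norm _ _)).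
Qed.

Lemma lipschitz_on_ball (R : realType) (m : nat) (g : 'rV[R]_m -> R) (B : R) :
  class_C 1 g -> exists2 K, 0 <= K &
    forall x y, `|x| <= B -> `|y| <= B -> `|g y - g x| <= K * `|y - x|.
Proof.
move=> [dg cg].
have /choice[K HK] (j : 'I_m) : exists K, 0 <= K /\
    forall x, `|x| <= B -> `|gradient g x 0 j| <= K.
  by have [K K0 gK] := bounded_on_ball B (cg j); exists K.
have K0 : 0 <= \sum_j K j by apply: sumr_ge0 => j _; exact: (HK j).1.
(* norm_dotv_le needs one bound for all coordinates: the sum of the K j. *)
exists ((\sum_j K j) * m%:R); first by rewrite mulr_ge0.
move=> x y xB yB; have [c c01 ->] := mean_value_rV x y dg.
apply: norm_dotv_le => j.
apply: (@le_trans _ _ (K j)).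
  by apply: (HK j).2; rewrite -[_ + _]subr0 norm_segment_le ?subr0.
by rewrite (bigD1 j)//= lerDl sumr_ge0// => i _; exact: (HK i).1.
Qed.

Lemma taylor1_on_ball (R : realType) (m : nat) (g : 'rV[R]_m -> R) (B : R) :
  class_C 2 g -> exists2 K, 0 <= K &
    forall x y, `|x| <= B -> `|y| <= B ->
      `|g y - (g x + dotv (gradient g x) (y - x))| <= K * `|y - x| ^+ 2.
Proof.
move=> [dg cg].
have /choice[K HK] (j : 'I_m) : exists K, 0 <= K /\
    forall x y, `|x| <= B -> `|y| <= B ->
      `|gradient g y 0 j - gradient g x 0 j| <= K * `|y - x|.
  by have [K K0 gK] := lipschitz_on_ball B (cg j); exists K.
have K0 : 0 <= \sum_j K j by apply: sumr_ge0 => j _; exact: (HK j).1.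
exists ((\sum_j K j) * m%:R); first by rewrite mulr_ge0.
move=> x y xB yB; have [c c01 E] := mean_value_rV x y dg.
set z := x + c *: (y - x) in E.
have -> : g y - (g x + dotv (gradient g x) (y - x)) =
    dotv (gradient g z - gradient g x) (y - x).
  rewrite opprD addrA E /dotv -sumrB.
  by apply: eq_bigr => j _; rewrite !mxE mulrBl.
have zB : `|z| <= B by rewrite -[z]subr0 norm_segment_le ?subr0.
have zx : `|z - x| <= `|y - x|.
  by rewrite norm_segment_le// subrr normr0.
rewrite (le_trans (norm_dotv_le (c := (\sum_j K j) * `|y - x|) _ _))//.
  move=> j; rewrite subr_rVE (le_trans ((HK j).2 x z xB zB))//.
  rewrite ler_pM ?(HK j).1//.
  by rewrite (bigD1 j)//= lerDl sumr_ge0// => i _; exact: (HK i).1.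
by rewrite expr2; nra.
Qed.

(** The mean of g over the segment from v to w, compared with the value of g at
    a third point c: a first order bound, and a second order bound in which the
    distance from the midpoint of the segment to c remains. *)
Lemma segment_integral_bounds (R : realType) (m : nat) (g : 'rV[R]_m -> R)
    (B : R) : class_C 2 g -> exists2 K, 0 <= K &
  forall v w c, `|v| <= B -> `|w| <= B -> `|c| <= B ->
    let I := \int[lebesgue_measure]_(s in `[0 : R, 1]) g (v + s *: (w - v)) in
    `|I - g c| <= K * (`|v - c| + `|w - c|) /\
    `|I - g c| <= K * ((`|v - c| + `|w - c|) ^+ 2 + `|2^-1 *: (v + w) - c|).
Proof.
move=> gC2; have [dg cg] := gC2.
have gC1 : class_C 1 g.
  by split=> // j; exact: (class_C_continuous (k := 1%N) (cg j)).
have [L L0 HL] := lipschitz_on_ball B gC1.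
have [T T0 HT] := taylor1_on_ball B gC2.
have /choice[G HG] (j : 'I_m) : exists K, 0 <= K /\
    forall x, `|x| <= B -> `|gradient g x 0 j| <= K.
  have [K K0 gK] := bounded_on_ball B (class_C_continuous (k := 1%N) (cg j)).
  by exists K.
have G0 : 0 <= \sum_j G j by apply: sumr_ge0 => j _; exact: (HG j).1.
have D0 : 0 <= (\sum_j G j) * m%:R by rewrite mulr_ge0.
exists (L + T + (\sum_j G j) * m%:R) => [|v w c vB wB cB I]; first lra.
set r := `|v - c| + `|w - c|.
have r0 : 0 <= r by rewrite addr_ge0.
have cont : continuous (fun s : R => g (v + s *: (w - v))).
  move=> t; apply: (@continuous_comp _ _ _ (fun s : R => v + s *: (w - v)) g).
    exact: line_continuous.
  exact: class_C_continuous gC1 _.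
have sB (s : R) : 0 <= s <= 1 -> `|v + s *: (w - v)| <= B.
  by move=> s01; rewrite -[_ + _]subr0 norm_segment_le ?subr0.
have sr (s : R) : 0 <= s <= 1 -> `|v + s *: (w - v) - c| <= r.
  by move=> s01; rewrite norm_segment_le// /r ?lerDl ?lerDr.
split.
  have := @Rintegral_affine_approx R _ (g c) 0 (L * r) cont.
  rewrite mul0r addr0 => H.
  rewrite (le_trans (H _))//; last by nra.
  move=> s s01; rewrite mulr0 addr0 (le_trans (HL _ _ cB (sB _ s01)))//.
  by rewrite ler_wpM2l// sr.
pose q := gradient g c.
have := @Rintegral_affine_approx R _ (g c + dotv q (v - c)) (dotv q (w - v))
  (T * r ^+ 2) cont.
(* Along the segment, the first order Taylor polynomial of g at c is affine
   in the parameter; its mean is its value at the midpoint. *)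
have -> : g c + dotv q (v - c) + dotv q (w - v) / 2 =
    g c + dotv q (2^-1 *: (v + w) - c).
  rewrite -addrA /dotv mulr_suml -big_split/=; congr (_ + _).
  by apply: eq_bigr => j _; rewrite !mxE; field.
move=> H.
rewrite -[I - _](subrKA (g c + dotv q (2^-1 *: (v + w) - c))).
rewrite (le_trans (ler_normD _ _))//.
have Hq : `|dotv q (2^-1 *: (v + w) - c)| <=
    (\sum_j G j) * m%:R * `|2^-1 *: (v + w) - c|.
  apply: norm_dotv_le => j; rewrite (le_trans ((HG j).2 c cB))//.
  by rewrite (bigD1 j)//= lerDl sumr_ge0// => i _; exact: (HG i).1.
have -> : g c + dotv q (2^-1 *: (v + w) - c) - g c =
  dotv q (2^-1 *: (v + w) - c) by rewrite addrC addKr.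
have HI : `|I - (g c + dotv q (2^-1 *: (v + w) - c))| <= T * r ^+ 2.
  apply: H => s s01.
  have -> : g c + dotv q (v - c) + s * dotv q (w - v) =
      g c + dotv q (v + s *: (w - v) - c).
    rewrite -addrA /dotv mulr_sumr -big_split/=; congr (_ + _).
    by apply: eq_bigr => j _; rewrite !mxE; ring.
  rewrite (le_trans (HT _ _ cB (sB _ s01)))// ler_wpM2l//.
  by rewrite lerXn2r ?nnegrE// sr.
have e0 : 0 <= `|2^-1 *: (v + w) - c| by [].
have r20 : 0 <= r ^+ 2 by rewrite exprn_ge0.
rewrite (le_trans (lerD HI Hq))//; move: (r ^+ 2) r20 => r2 r20.
move: (`|_|) e0 => e e0; nra.
Qed.

(** * Smooth curves *)

(** The intermediate point depends on the coordinate j. *)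
Lemma mean_value_curve (R : realType) (m : nat) (a b : R)
    (v v' : R -> 'rV[R]_m) (x y : R) (j : 'I_m) :
  derivable_oo_LRcontinuous v a b -> {in `]a, b[, derive1 v =1 v'} ->
  a <= x -> x < y -> y <= b ->
  exists2 c, x < c < y & v y 0 j - v x 0 j = v' c 0 j * (y - x).
Proof.
move=> dv v'E ax xy yb.
have xyab : `[x, y] `<=` `[a, b].
  by apply: subset_itv; rewrite bnd_simp.
have dvj (t : R) : t \in `]x, y[ ->
    is_derive t 1 (fun s => v s 0 j) (v' t 0 j).
  rewrite in_itv/= => /andP[xt ty].
  have tab : t \in `]a, b[.
    by rewrite in_itv/= (le_lt_trans ax)// (lt_le_trans ty).
  have dvt : derivable v t 1 by case: dv => + _ _; exact.
  split; first exact: (derivable_mxP v t 1).1.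
  by rewrite -(v'E t tab) derive1E derive_mx// mxE.
have cv : {within `[x, y], continuous v}.
  exact/derivable_oo_LRcontinuous_within/(derivable_oo_continuousW _ xyab).
have [c cxy ->] := MVT xy dvj
  (fun t => continuous_comp (cv t) (@coord_continuous R 1 m 0 j (v t))).
by exists c => //; move: cxy; rewrite in_itv.
Qed.

Lemma lipschitz_curve (R : realType) (m : nat) (a b : R)
    (v v' : R -> 'rV[R]_m) (M : R) :
  derivable_oo_LRcontinuous v a b -> {in `]a, b[, derive1 v =1 v'} ->
  (forall x, a <= x <= b -> `|v' x| <= M) ->
  forall x y, a <= x <= b -> a <= y <= b -> `|v x - v y| <= M * `|x - y|.
Proof.
move=> dv v'E v'M x y; wlog xy : x y / x < y => [H xab yab|].
  have [xy|yx|->] := ltgtP x y; first exact: H.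
  - by rewrite distrC (distrC x) H.
  - by rewrite !subrr !normr0 mulr0.
move=> /andP[ax xb] /andP[ay yb].
have M0 : 0 <= M by rewrite (le_trans _ (v'M x _)) ?ax.
rewrite distrC (distrC x).
apply: norm_rV_le => [|j]; first by rewrite mulr_ge0.
have [c /andP[xc cy]] := mean_value_curve j dv v'E ax xy yb.
rewrite !mxE => ->; rewrite normrM ler_wpM2r//.
rewrite (le_trans (coord_le_norm _ _))// v'M//.
by rewrite (le_trans ax (ltW xc)) (le_trans (ltW cy)).
Qed.

(** The bound on a second difference: by the mean value theorem on both sides of
    x, it is h times an increment of v' over a distance at most 2h. *)
Lemma midpoint_curve (R : realType) (m : nat) (a b : R)
    (v v' v'' : R -> 'rV[R]_m) (M : R) :
  derivable_oo_LRcontinuous v a b -> {in `]a, b[, derive1 v =1 v'} ->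
  derivable_oo_LRcontinuous v' a b -> {in `]a, b[, derive1 v' =1 v''} ->
  (forall x, a <= x <= b -> `|v'' x| <= M) ->
  forall x h, 0 < h -> a <= x - h -> x + h <= b ->
    `|2^-1 *: (v (x - h) + v (x + h)) - v x| <= M * h ^+ 2.
Proof.
move=> dv v'E dv' v''E v''M x h h0 ax xb.
have M0 : 0 <= M by rewrite (le_trans _ (v''M x _))//; lra.
apply: norm_rV_le => [|j]; first by rewrite mulr_ge0// exprn_ge0// ltW.
have [||c1 /andP[? ?] E1] := mean_value_curve (x := x - h) (y := x) j dv v'E ax.
- by lra.
- by lra.
have [||c2 /andP[? ?] E2] :=
  mean_value_curve (x := x) (y := x + h) j dv v'E _ _ xb.
- by lra.
- by lra.
have := lipschitz_curve dv' v''E v''M (x := c2) (y := c1).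
have -> : (2^-1 *: (v (x - h) + v (x + h)) - v x) 0 j =
    2^-1 * h * (v' c2 - v' c1) 0 j.
  move: E1 E2; rewrite !mxE.
  by move: (v x 0 j) (v (x - h) 0 j) (v (x + h) 0 j) => p q r E1 E2; lra.
rewrite normrM ger0_norm; last by lra.
move=> H; have {}H : `|v' c2 - v' c1| <= M * (2 * h).
  apply: le_trans (H _ _) _; [lra|lra|].
  by rewrite ler_wpM2l// ger0_norm; lra.
rewrite (le_trans (ler_wpM2l _ (le_trans (coord_le_norm _ _) H)))//; first lra.
by rewrite expr2 le_eqVlt; apply/orP; left; apply/eqP; field.
Qed.

Lemma bounded_curve (R : realType) (m : nat) (a b : R) (v : R -> 'rV[R]_m) :
  derivable_oo_LRcontinuous v a b ->
  exists M, forall x, a <= x <= b -> `|v x| <= M.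
Proof.
move=> /derivable_oo_LRcontinuous_within cv.
have /compact_bounded[K [_ vK]] :=
  continuous_compact cv (@segment_compact _ a b).
exists (`|K| + 1) => x xab.
apply: (vK (`|K| + 1)); first by rewrite ltr_pwDr// ler_norm.
by exists x => //=; rewrite in_itv.
Qed.

Lemma smooth_curve_onT (R : realType) (m : nat) (a b : R)
    (u : R -> 'rV[R]_m) : smooth_curve u -> smooth_curve_on a b u.
Proof.
move=> su; exists (fun k => derive1n k u); split=> [x _|k]; first by [].
have cu : continuous (derive1n k u).
  move=> x; apply/differentiable_continuous; exact/derivable1_diffP.
split=> [|x _]; last by [].
split=> [x _||]; first exact: su.
- exact/cvg_at_right_filter/cu.
- exact/cvg_at_left_filter/cu.
Qed.

(** The bounds of segment_integral_bounds on the image of a smooth curve, with a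
    constant uniform over the interval. *)
Lemma segment_integral_curve (R : realType) (m : nat) (a b : R)
    (g : 'rV[R]_m -> R) (u : R -> 'rV[R]_m) :
  class_C 2 g -> smooth_curve_on a b u -> exists2 C, 0 <= C &
  (forall x y z, a <= x <= b -> a <= y <= b -> a <= z <= b ->
    `|\int[lebesgue_measure]_(s in `[0 : R, 1]) g (u x + s *: (u y - u x))
      - g (u z)| <= C * (`|x - z| + `|y - z|)) /\
  (forall x h, 0 < h -> a <= x - h -> x + h <= b ->
    `|\int[lebesgue_measure]_(s in `[0 : R, 1])
        g (u (x - h) + s *: (u (x + h) - u (x - h))) - g (u x)| <= C * h ^+ 2).
Proof.
move=> gC2 [v [v0u dv]].
have vu x : a <= x <= b -> u x = v 0%N x by move=> xab; rewrite v0u// in_itv.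
have [B HB] := bounded_curve (dv 0%N).1.
have [M1 HM1] := bounded_curve (dv 1%N).1.
have [M2 HM2] := bounded_curve (dv 2%N).1.
have Lip := lipschitz_curve (dv 0%N).1 (dv 0%N).2 HM1.
have Mid := midpoint_curve (dv 0%N).1 (dv 0%N).2 (dv 1%N).1 (dv 1%N).2 HM2.
have [K K0 HK] := segment_integral_bounds B gC2.
exists (K * `|M1| + K * (4 * M1 ^+ 2 + `|M2|)).
  by rewrite addr_ge0// mulr_ge0// addr_ge0// mulr_ge0// sqr_ge0.
split=> [x y z xab yab zab|x h h0 axh xhb].
  rewrite !vu//.
  have [H _] := HK _ _ _ (HB _ xab) (HB _ yab) (HB _ zab).
  rewrite (le_trans H)//.
  have L1 := le_trans (Lip _ _ xab zab) (ler_wpM2r (normr_ge0 _) (ler_norm M1)).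
  have L2 := le_trans (Lip _ _ yab zab) (ler_wpM2r (normr_ge0 _) (ler_norm M1)).
  have := ler_wpM2l K0 (lerD L1 L2).
  have : 0 <= K * (4 * M1 ^+ 2 + `|M2|) * (`|x - z| + `|y - z|).
    by rewrite !mulr_ge0// addr_ge0// mulr_ge0// sqr_ge0.
  by lra.
have xab : a <= x <= b by lra.
have xmab : a <= x - h <= b by lra.
have xpab : a <= x + h <= b by lra.
rewrite !vu//.
have [_ H] := HK _ _ _ (HB _ xmab) (HB _ xpab) (HB _ xab).
rewrite (le_trans H)//.
have M1h : 0 <= M1 by rewrite (le_trans _ (HM1 _ xab)).
have M2h : 0 <= M2 by rewrite (le_trans _ (HM2 _ xab)).
have {}Mid := Mid x h h0 axh xhb.
have L1 := Lip _ _ xmab xab; have L2 := Lip _ _ xpab xab.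
have sq : (`|v 0%N (x - h) - v 0%N x| + `|v 0%N (x + h) - v 0%N x|) ^+ 2 <=
    (M1 * (2 * h)) ^+ 2.
  rewrite lerXn2r ?nnegrE ?addr_ge0//; first by rewrite mulr_ge0//; lra.
  rewrite (le_trans (lerD L1 L2))//.
  have -> : x - h - x = - h by ring.
  have -> : x + h - x = h by ring.
  by rewrite normrN gtr0_norm//; lra.
rewrite ger0_norm// (ger0_norm M2h).
have : K * M1 * h ^+ 2 >= 0 by rewrite !mulr_ge0// ltW.
have := ler_wpM2l K0 (lerD sq Mid).
rewrite exprMn (exprMn _ 2 h).
by move: (h ^+ 2) (_ ^+ 2) => h2 M12; lra.
Qed.

Lemma segment_mean_curve (R : realType) (m : nat) (a b : R)
    (f : 'rV[R]_m -> R) (u : R -> 'rV[R]_m) :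
  smooth f -> smooth_curve_on a b u -> exists C : R,
  (forall x y z, a <= x <= b -> a <= y <= b -> a <= z <= b ->
    `|segment_mean (gradient f) (u x) (u y) - gradient f (u z)|
      <= C * (`|x - z| + `|y - z|)) /\
  (forall x h, 0 < h -> a <= x - h -> x + h <= b ->
    `|segment_mean (gradient f) (u (x - h)) (u (x + h)) - gradient f (u x)|
      <= C * h ^+ 2).
Proof.
move=> sf su.
have mE v w p (j : 'I_m) : (segment_mean (gradient f) v w - gradient f p) 0 j =
    \int[lebesgue_measure]_(s in `[0 : R, 1])
      gradient f (v + s *: (w - v)) 0 j - gradient f p 0 j.
  by rewrite subr_rVE [segment_mean _ _ _ _ _]mxE.
have /choice[C HC] (j : 'I_m) : exists C, 0 <= C /\
    ((forall x y z, a <= x <= b -> a <= y <= b -> a <= z <= b ->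
    `|(segment_mean (gradient f) (u x) (u y) - gradient f (u z)) 0 j|
      <= C * (`|x - z| + `|y - z|)) /\
    (forall x h, 0 < h -> a <= x - h -> x + h <= b ->
    `|(segment_mean (gradient f) (u (x - h)) (u (x + h))
       - gradient f (u x)) 0 j| <= C * h ^+ 2)).
  (* Since f is of class C^3, its partial derivatives are of class C^2. *)
  have [C C0 [H1 H2]] := segment_integral_curve ((sf 3%N).2 j) su.
  exists C; split=> //; split=> [x y z xab yab zab|x h h0 axh xhb].
    by rewrite mE H1.
  by rewrite mE H2.
have C0 : 0 <= \sum_j C j by apply: sumr_ge0 => j _; exact: (HC j).1.
have Cj j : C j <= \sum_j C j.
  by rewrite (bigD1 j)//= lerDl sumr_ge0// => i _; exact: (HC i).1.
exists (\sum_j C j); split=> [x y z xab yab zab|x h h0 axh xhb].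
  apply: norm_rV_le => [|j]; first by rewrite mulr_ge0// addr_ge0.
  have [_ [H _]] := HC j.
  by rewrite (le_trans (H _ _ _ xab yab zab))// ler_wpM2r// addr_ge0.
have h20 : 0 <= h ^+ 2 by rewrite exprn_ge0// ltW.
apply: norm_rV_le => [|j]; first by rewrite mulr_ge0.
have [_ [_ H]] := HC j.
by rewrite (le_trans (H _ _ h0 axh xhb))// ler_wpM2r.
Qed.

(** * Grids *)

(** On a periodic grid the cyclic neighbours of the node x have the same values
    as the points x + h and x - h, also when the index wraps around. *)
Lemma node_ordS (R : realType) (T : Type) (x0 L h : R) (n : nat) (u : R -> T)
    (i : 'I_n) : (forall x, u (x + L) = u x) -> n%:R * h = L ->
  u (node x0 h (ordS i)) = u (node x0 h i + h).
Proof.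
move=> uL nh; have := ltn_ord i; rewrite leq_eqVlt /node /= => /orP[/eqP iN|iN].
  have -> : (i.+1 %% n)%N = 0%N by rewrite iN modnn.
  have nE : n%:R = i%:R + 1 :> R by rewrite natr1 iN.
  by rewrite mul0r addr0 -(uL x0) -nh nE; congr (u _); ring.
by rewrite modn_small// -natr1; congr (u _); ring.
Qed.

Lemma node_ord_pred (R : realType) (T : Type) (x0 L h : R) (n : nat)
    (u : R -> T) (i : 'I_n) : (forall x, u (x + L) = u x) -> n%:R * h = L ->
  u (node x0 h (ord_pred i)) = u (node x0 h i - h).
Proof.
move=> uL nh; rewrite /node /=; case: i => -[|i] /= iN.
  rewrite add0n modn_small ?prednK// -[in RHS](uL _) -nh.
  by rewrite -[in X in _ = X](prednK iN) -natr1; congr (u _); ring.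
rewrite modnDr modn_small; last exact: ltnW.
by rewrite -[in RHS]natr1; congr (u _); ring.
Qed.

Theorem lemma3p2 (R : realType) (m : nat) (hm : (1 <= m)%N) :
  (* chain rule *)
  (forall f : 'rV[R]_m -> R, class_C 1 f -> forall h : R, 0 < h ->
     (forall (n : nat) (u : 'I_n -> 'rV[R]_m) (i : 'I_n),
        D_per h (f \o u) i = dotv (A_per (gradient f) u i) (D_per h u i)) /\
     (forall (N : nat) (u : 'I_N.+1 -> 'rV[R]_m) (i : 'I_N.+1), (0 < N)%N ->
        D_sbp h (f \o u) i = dotv (A_sbp (gradient f) u i) (D_sbp h u i))) /\
  (* order of accuracy *)
  (forall f : 'rV[R]_m -> R, smooth f ->
     (* periodic case, period L *)
     (forall (x0 L : R) (u : R -> 'rV[R]_m), 0 < L ->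
        smooth_curve u -> (forall x, u (x + L) = u x) ->
        exists C : R, \forall h \near (0 : R)^'+,
          forall n : nat, n%:R * h = L -> forall i : 'I_n,
            `| A_per (gradient f) (u \o node x0 h (n := n)) i
               - gradient f (u (node x0 h i)) | <= C * h ^+ 2) /\
     (* non-periodic case, domain [a, b] *)
     (forall (a b : R) (u : R -> 'rV[R]_m), a < b -> smooth_curve_on a b u ->
        exists C : R, \forall h \near (0 : R)^'+,
          forall N : nat, N%:R * h = b - a -> forall i : 'I_N.+1,
            let err := A_sbp (gradient f) (u \o node a h (n := N.+1)) i
                       - gradient f (u (node a h i)) in
            ((0 < i < N)%N -> `| err | <= C * h ^+ 2) /\
            (i = ord0 \/ i = ord_max -> `| err | <= C * h))).
Proof.
split=> [f fC1 h h0|f sf]; split.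
- move=> n u i; rewrite /D_per /A_per dotvZr -chain_rule_segment_mean//.
- move=> N u i N0; rewrite /D_sbp /A_sbp.
  by case: (i == ord0); [|case: (i == ord_max)];
    rewrite dotvZr -chain_rule_segment_mean.
- move=> x0 L u L0 su uL.
  (* A node and its two neighbours lie in [x0 - L, x0 + L], since h <= L. *)
  have [C [_ HC]] :=
    segment_mean_curve sf (smooth_curve_onT (x0 - L) (x0 + L) su).
  exists C; near=> h => n nh i; have h0 : 0 < h by [].
  rewrite /A_per /= (node_ordS _ _ uL nh) (node_ord_pred _ _ uL nh).
  have : (i.+1%:R : R) <= n%:R by rewrite ler_nat.
  have : 0 <= (i%:R : R) by [].
  rewrite -natr1 => i0 iN; apply: HC => //; rewrite /node -nh; nra.
- move=> a b u ab su.
  have [C [HC1 HC2]] := segment_mean_curve sf su.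
  exists C; near=> h => N Nh i; have h0 : 0 < h by [].
  have nodeab (k : 'I_N.+1) : a <= node a h k <= b.
    have : (k%:R : R) <= N%:R by rewrite ler_nat -ltnS.
    have : 0 <= (k%:R : R) by [].
    by rewrite /node => k0 kN; apply/andP; split; nra.
  have N0 : (0 < N)%N.
    rewrite lt0n; apply/eqP => N0; move: Nh; rewrite N0 mul0r; lra.
  split=> [/andP[i0 iN]|].
    rewrite /A_sbp -!val_eqE/= gtn_eqF// ltn_eqF//=.
    have -> : node a h (inord i.+1 : 'I_N.+1) = node a h i + h.
      by rewrite /node inordK// -natr1; ring.
    have -> : node a h (inord i.-1 : 'I_N.+1) = node a h i - h.
      rewrite /node inordK; last by rewrite (leq_ltn_trans (leq_pred _)).
      by rewrite -[in RHS](prednK i0) -natr1; ring.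
    apply: HC2 => //.
      have : (1 : R) <= i%:R by rewrite ler1n.
      by rewrite /node; nra.
    have : (i.+1%:R : R) <= N%:R by rewrite ler_nat.
    by rewrite /node -natr1; nra.
  have n1 : node a h (inord 1 : 'I_N.+1) = a + h.
    by rewrite /node inordK ?ltnS// mul1r.
  have n0 : node a h (ord0 : 'I_N.+1) = a by rewrite /node mul0r addr0.
  have nN : node a h (ord_max : 'I_N.+1) = b by rewrite /node /= Nh; ring.
  have nN1 : node a h (inord N.-1 : 'I_N.+1) = b - h.
    rewrite /node inordK; last by rewrite ltnS leq_pred.
    have : (N%:R : R) = N.-1%:R + 1 by rewrite natr1 prednK.
    by move=> NE; rewrite NE in Nh; lra.
  case=> iE; rewrite /A_sbp iE.
    rewrite eqxx/=.
    have := HC1 _ _ _ (nodeab ord0) (nodeab (inord 1)) (nodeab ord0).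
    by rewrite n0 n1 subrr normr0 add0r [a + h]addrC addrK gtr0_norm.
  (* The first node takes precedence in the definition of the operator; the two
     boundary nodes differ because N is positive. *)
  have -> : (ord_max == ord0 :> 'I_N.+1) = false.
    by apply/negbTE; rewrite -val_eqE/= -lt0n.
  rewrite eqxx /=.
  have := HC1 _ _ _ (nodeab (inord N.-1)) (nodeab ord_max) (nodeab ord_max).
  by rewrite nN nN1 subrr normr0 addr0 [b - h]addrC addrK normrN gtr0_norm.
Unshelve. all: by end_near. Qed.
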